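(* Let $\nu\in\mathbb{R}$, $t>0$ and $n\in\mathbb{N}$. The orthogonal polynomials $P_n^\nu(x,t)$ satisfy the first order linear differential-difference equation $$x^2 \frac{\partial}{\partial x} P_n^\nu(x,t) = \left[ nx - A_n^2(t) - \frac{b_n(t)}{a_n(t)} \right] P_n^\nu(x,t) + A_n(t) \left[ x+B_n(t)-\nu-1-2n\right] P_{n-1}^\nu(x,t).$$
   Context: $\mathbb{N}=\{1,2,\dots\}$, $\mathbb{N}_0=\{0,1,2,\dots\}$. For $\nu\in\mathbb{R}$, $t>0$, $\{P_n^\nu(x,t)\}_{n\ge 0}$ is the sequence of polynomials in $x$ with $P_n^\nu$ of degree exactly $n$ and $\int_0^\infty P_n^\nu(x,t)P_m^\nu(x,t)e^{-x-t/x}x^\nu dx=\delta_{n,m}$ for $n,m\in\mathbb{N}_0$; the sign is fixed so that the leading coefficient has sign $(-1)^n$. Write $P_n^\nu(x,t)=\sum_{k=0}^n a_{n,k}(t)x^k$, $a_n(t)=a_{n,n}(t)\neq0$, $b_n(t)=a_{n,n-1}(t)$ (with $b_0=0$). Put $A_n(t)=a_{n-1}(t)/a_n(t)$ for $n\ge1$, and $B_n(t)=\frac{b_n(t)}{a_n(t)}-\frac{b_{n+1}(t)}{a_{n+1}(t)}$ for $n\ge 0$; these are the coefficients in the three term recurrence $xP_n^\nu=A_{n+1}P_{n+1}^\nu+B_nP_n^\nu+A_nP_{n-1}^\nu$ (with $P_{-1}^\nu\equiv0$). *)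

(* Defs.v *)
From HB Require Import structures.
From mathcomp Require Import all_boot all_order all_algebra.
From mathcomp Require Import all_classical all_reals all_analysis.

Set Implicit Arguments.
Unset Strict Implicit.
Unset Printing Implicit Defensive.

Import Order.TTheory GRing.Theory Num.Theory.
Import numFieldNormedType.Exports.

Local Open Scope classical_set_scope.
Local Open Scope ring_scope.

Definition weight (R : realType) (nu t x : R) : R :=
  expR (- x - t / x) * x `^ nu.

(* For t > 0 the weight decays rapidly at 0 and at +oo, so the integrand below
   is Lebesgue integrable for all polynomials. The conditions determine P
   uniquely; the dependence of P on nu and t is left implicit. *)
Definition orthonormal_polys (R : realType) (nu t : R) (P : nat -> {poly R})
    : Prop :=
  [/\ forall n, size (P n) = n.+1,
      forall n, 0 < (-1) ^+ n * lead_coef (P n)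
    & forall n m,
        (\int[lebesgue_measure]_(x in `]0%R, +oo[)
           ((P n).[x] * (P m).[x] * weight nu t x)%:E)%E
        = ((n == m)%:R : R)%:E].

Section Coefficients.
Variables (R : realType) (P : nat -> {poly R}).

Definition coef_a (n : nat) : R := (P n)`_n.

Definition coef_b (n : nat) : R := if n is k.+1 then (P n)`_k else 0.

(* Meaningful for n >= 1 only. *)
Definition coef_A (n : nat) : R := coef_a n.-1 / coef_a n.

Definition coef_B (n : nat) : R :=
  coef_b n / coef_a n - coef_b n.+1 / coef_a n.+1.

End Coefficients.

(* Main.v *)
Require Import Defs.
From HB Require Import structures.
From mathcomp Require Import all_boot all_order all_algebra.
From mathcomp Require Import ring lra.
From mathcomp Require Import all_classical all_reals all_analysis.
From mathcomp Require Import measurable_realfun.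

Set Implicit Arguments.
Unset Strict Implicit.
Unset Printing Implicit Defensive.

Import Order.TTheory GRing.Theory Num.Theory.
Import numFieldNormedType.Exports.

Local Open Scope classical_set_scope.
Local Open Scope ring_scope.

(** Let L p be the integral of p times the weight w over ]0, +oo[. The logarithmic
    derivative of w is - 1 + t / x^2 + nu / x, so x^2 w' is a polynomial
    multiple of w, and
      (x^2 p w)' = (x^2 p' + ((2 + nu) x - x^2 + t) p) w
    for every polynomial p. Since w decays faster than any power of x at both
    ends, integrating gives the Pearson identity
    [weight_functional_pearson]: L kills the polynomial factor on the right.

    The rest is algebra with the linear functional L
    ([structure_relation]). Let D be the difference of the two sides of the
    claimed equation. The two highest coefficients cancel, so D has degree
    less than n, and it is enough to show L (D q) = 0 for all q of degree less
    than n ([eq0_of_orth]). The Pearson identity for P_n q moves the derivative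
    off P_n, after which L (D q) is a combination of L (P_n r) and
    L (P_(n-1) s) with deg r <= n + 1 and deg s <= n. Such pairings see only
    the two top coefficients of r and s ([orth_degree_nS]), and
    the value of B_n makes the two contributions cancel.

    On the analytic side, orthonormality itself provides the integrability: a
    finite integral of P_n P_m w makes that product integrable, and every
    polynomial is a combination of the products P_n P_0
    ([integrable_horner_weight]). *)

(** * Orthonormal polynomials for a linear functional *)

Section OrthonormalFunctional.
Variables (F : fieldType) (L : {poly F} -> F) (P : nat -> {poly F}).
Hypothesis L_linear : scalar L.
Hypothesis size_P : forall n, size (P n) = n.+1.
Hypothesis P_orth : forall n m, L (P n * P m) = (n == m)%:R.

Lemma functionalD p q : L (p + q) = L p + L q.
Proof. by have := L_linear 1 p q; rewrite scale1r mul1r. Qed.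

Lemma functional0 : L 0 = 0.
Proof. by apply: (addrI (L 0)); rewrite -functionalD !addr0. Qed.

Lemma functionalZ a p : L (a *: p) = a * L p.
Proof. by have := L_linear a p 0; rewrite !addr0 functional0 addr0. Qed.

Lemma functionalB p q : L (p - q) = L p - L q.
Proof. by rewrite functionalD -scaleN1r functionalZ mulN1r. Qed.

Lemma leading_neq0 n : (P n)`_n != 0.
Proof.
have := lead_coef_eq0 (P n).
by rewrite lead_coefE size_P /= -size_poly_eq0 size_P => ->.
Qed.

Lemma size_sub_leading n (q : {poly F}) : (size q <= n.+1)%N ->
  (size (q - (q`_n / (P n)`_n) *: P n)%R <= n)%N.
Proof.
move=> sq; apply/leq_sizeP => j; rewrite leq_eqVlt => /predU1P[<-|ltnj].
  by rewrite coefB coefZ divfK ?subrr ?leading_neq0.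
rewrite coefB coefZ (nth_default _ (leq_trans sq ltnj)).
by rewrite (@nth_default _ _ (P n) j) ?size_P // mulr0 subrr.
Qed.

(** P_0, ..., P_(n-1) span the polynomials of degree less than n. *)
Lemma orth_low_degree n (q : {poly F}) : (size q <= n)%N -> L (P n * q) = 0.
Proof.
suff H m : (m <= n)%N -> forall p : {poly F}, (size p <= m)%N -> L (P n * p) = 0.
  exact: H.
elim: m => [_ p|m IHm ltmn p sp].
  by rewrite leqn0 size_poly_eq0 => /eqP->; rewrite mulr0 functional0.
rewrite -(subrK ((p`_m / (P m)`_m) *: P m) p) mulrDr functionalD.
rewrite (IHm (ltnW ltmn)) ?size_sub_leading // -scalerAr functionalZ P_orth.
by rewrite gtn_eqF // mulr0 addr0.
Qed.

Lemma orth_degree_n n (q : {poly F}) : (size q <= n.+1)%N ->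
  L (P n * q) = q`_n / (P n)`_n.
Proof.
move=> sq; rewrite -[in LHS](subrK ((q`_n / (P n)`_n) *: P n) q) mulrDr.
rewrite functionalD orth_low_degree ?size_sub_leading // add0r.
by rewrite -scalerAr functionalZ P_orth eqxx mulr1.
Qed.

(** Subtracting from q the multiple of P_(n+1) that removes its top
    coefficient does not change the pairing with P_n, but it changes the next
    coefficient of q; this is where b_(n+1) / a_(n+1) comes from. *)
Lemma orth_degree_nS n (q : {poly F}) : (size q <= n.+2)%N ->
  L (P n * q) = (q`_n - q`_n.+1 * ((P n.+1)`_n / (P n.+1)`_n.+1)) / (P n)`_n.
Proof.
move=> sq.
rewrite -[in LHS](subrK ((q`_n.+1 / (P n.+1)`_n.+1) *: P n.+1) q) mulrDr.
rewrite functionalD orth_degree_n ?size_sub_leading //.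
rewrite -scalerAr functionalZ P_orth ltn_eqF // mulr0 addr0.
by rewrite coefB coefZ mulrAC mulrA.
Qed.

(** If q has degree m, its pairing with P_m is the leading coefficient of q
    divided by that of P_m. *)
Lemma eq0_of_orth n (q : {poly F}) : (size q <= n)%N ->
  (forall p : {poly F}, (size p <= n)%N -> L (q * p) = 0) -> q = 0.
Proof.
move=> sq q_orth; apply/eqP; rewrite -size_poly_eq0; case Eq: (size q) => [//|m].
have q_n0 : q`_m != 0.
  by have := lead_coef_eq0 q; rewrite lead_coefE Eq /= -size_poly_eq0 Eq => ->.
have := orth_degree_n (n := m) (q := q); rewrite Eq leqnn mulrC => /(_ isT).
rewrite q_orth ?size_P -?Eq // => /esym /eqP.
by rewrite mulf_eq0 invr_eq0 (negPf q_n0) (negPf (leading_neq0 m)).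
Qed.

End OrthonormalFunctional.

(** * The structure relation from the Pearson identity *)

Lemma coef_X2_deriv (F : nzRingType) (p : {poly F}) k :
  ('X^2 * p^`())`_k.+1 = p`_k *+ k.
Proof.
by rewrite coefXnM; case: k => [|k]; rewrite // coef_deriv !subSS subn0.
Qed.

Section StructureRelation.
Variables (R : realType) (nu t : R) (L : {poly R} -> R) (P : nat -> {poly R}).
Hypothesis L_linear : scalar L.
Hypothesis size_P : forall n, size (P n) = n.+1.
Hypothesis P_orth : forall n m, L (P n * P m) = (n == m)%:R.
Hypothesis L_pearson : forall p : {poly R},
  L ('X^2 * p^`() + ((2 + nu) *: 'X - 'X^2 + t%:P) * p) = 0.

(** Both sides have the same coefficients from degree n + 1 upwards by the choice of
    the scalars, so it is enough to compare their pairings with polynomials q of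
    degree at most n. *)
Lemma structure_relation n :
  'X^2 * (P n.+1)^`() =
    (n.+1%:R *: 'X -
      (coef_A P n.+1 ^+ 2 + coef_b P n.+1 / coef_a P n.+1)%:P) * P n.+1
    + coef_A P n.+1 *:
      (('X + (coef_B P n.+1 - nu - 1 - 2 * n.+1%:R)%:P) * P n).
Proof.
set c := coef_A P n.+1 ^+ 2 + _; set A := coef_A P n.+1.
set d := coef_B P n.+1 - nu - 1 - _.
pose a := (P n)`_n; pose a1 := (P n.+1)`_n.+1; pose b1 := (P n.+1)`_n.
have a_n0 : a != 0 by exact: leading_neq0.
have a1_n0 : a1 != 0 by exact: leading_neq0.
have AE : A = a / a1 by [].
have cE : c = (a / a1) ^+ 2 + b1 / a1 by [].
have dE : d = b1 / a1 - (P n.+2)`_n.+1 / (P n.+2)`_n.+2 - nu - 1 - 2 * n.+1%:R.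
  by [].
apply/eqP; rewrite -subr_eq0; apply/eqP.
apply: (@eq0_of_orth _ L P L_linear size_P P_orth n.+1).
  apply/leq_sizeP => j nj.
  case: j nj => [//|j]; rewrite ltnS => nj.
  rewrite coefB coefD coef_X2_deriv coefZ !mulrDl mulNr coefB coefD -scalerAl.
  rewrite !coefCM coefZ !coefXM /=.
  move: nj; rewrite leq_eqVlt => /predU1P[<-|].
    (* Degree n + 1: the constant c was chosen to make it cancel. *)
    rewrite -/a -/a1 -/b1 nth_default ?size_P // AE cE -mulr_natr -natr1.
    by field.
  case: j => [//|j]; rewrite ltnS leq_eqVlt => /predU1P[<-|ltnj] /=.
    (* Degree n + 2: the leading terms of x^2 P' and (n + 1) x P. *)
    rewrite -/a -/a1 !(@nth_default _ _ _ n.+2) ?size_P //.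
    rewrite (@nth_default _ _ _ n.+1) ?size_P // AE -mulr_natr.
    by field.
  rewrite !(@nth_default _ _ (P _)) ?size_P // ?ltnS ?(ltnW ltnj) //.
    by rewrite !(mul0rn, mulr0, subr0, addr0).
  exact: leqW (ltnW ltnj).
move=> q sq.
pose r := ('X^2 - (2 + nu + n.+1%:R) *: 'X + (c - t)%:P) * q - 'X^2 * q^`().
pose s := ('X + d%:P) * q.
set D := (X in L (X * q)).
(* The first two summands are the expression that L kills, taken at P q; what is
   left contains no derivative of P. *)
have -> : D * q = 'X^2 * (P n.+1 * q)^`()
    + ((2 + nu) *: 'X - 'X^2 + t%:P) * (P n.+1 * q)
    + (P n.+1 * r - A *: (P n * s)).
  by rewrite /D /r /s derivM -!mul_polyC !polyCD !polyCN; ring.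
rewrite functionalD // L_pearson add0r functionalB // functionalZ //.
pose k := 2 + nu + n.+1%:R.
have coef_r j : r`_j.+1 =
    ('X * q)`_j - k * q`_j + (c - t) * q`_j.+1 - q`_j *+ j.
  rewrite /r coefB coef_X2_deriv mulrDl mulrBl coefD coefB -scalerAl coefZ.
  rewrite exprS expr1 -mulrA [('X * ('X * q))`_j.+1]coefXM.
  by rewrite [('X * q)`_j.+1]coefXM coefCM.
have coef_s j : s`_j = ('X * q)`_j + d * q`_j.
  by rewrite /s mulrDl coefD coefCM.
have q0 j : (n < j)%N -> q`_j = 0.
  by move=> nj; apply: nth_default; exact: leq_trans sq nj.
have sr : (size r <= n.+3)%N.
  apply/leq_sizeP => -[|[|j]] // nj; rewrite coef_r coefXM /= !q0 ?leqW //.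
  by rewrite !(mul0rn, mulr0, subr0, addr0).
have ss : (size s <= n.+2)%N.
  apply/leq_sizeP => -[|j] // nj; rewrite coef_s coefXM /= !q0 ?leqW //.
  by rewrite !(mulr0, addr0).
rewrite orth_degree_nS // orth_degree_nS //.
rewrite !coef_r !coef_s [('X * q)`_n.+1]coefXM /= (q0 n.+1) // (q0 n.+2) //.
rewrite -/a -/a1 -/b1 AE dE /k -mulr_natr -!natr1.
by field; rewrite a_n0 a1_n0 (leading_neq0 size_P n.+2).
Qed.
End StructureRelation.

(** * Decay and derivative of the weight *)

Lemma ln_le_linear (R : realType) (c s : R) : 0 <= c -> 0 < s ->
  exists C, forall y, 0 < y -> c * ln y <= s * y + C.
Proof.
rewrite le_eqVlt => /predU1P[<- s0|c0 s0].
  by exists 0 => y y0; rewrite mul0r addr0 mulr_ge0 // ltW.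
(* The scaling y = (s / c) y * (c / s) turns ln z < z into the claim with the
   prescribed slope s. *)
exists (c * ln (c / s)) => y y0.
have cs0 : 0 < c / s by rewrite divr_gt0.
have yE : y = (s / c * y) * (c / s) by field; rewrite !gt_eqF.
have sy0 : 0 < s / c * y by rewrite mulr_gt0 // divr_gt0.
rewrite {1}yE lnM ?posrE // mulrDr lerD2r -ler_pdivlMl //.
by rewrite mulrA [_^-1 * s]mulrC; exact/ltW/ln_sublinear.
Qed.

Lemma weight_ge0 (R : realType) (nu t x : R) : 0 <= weight nu t x.
Proof. by rewrite mulr_ge0 ?expR_ge0 ?powR_ge0. Qed.

(** The exponent a is an arbitrary real, so that this gives rapid decay both at
    +oo (a negative) and at 0 (a positive). After division by x^a the weight is
    the exponential of - x - t / x + (nu - a) ln x, and the logarithm is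
    absorbed by x or by t / x according to the sign of nu - a. *)
Lemma weight_le_powR (R : realType) (nu t a : R) : 0 < t ->
  exists C, forall x, 0 < x -> weight nu t x <= C * x `^ a.
Proof.
move=> t0; set b := nu - a.
suff [C HC] : exists C, forall x, 0 < x -> b * ln x <= x + t / x + C.
  exists (expR C) => x x0; rewrite /weight.
  have -> : x `^ nu = expR (b * ln x) * x `^ a.
    by rewrite /powR gt_eqF // -expRD /b; congr expR; ring.
  rewrite mulrA ler_wpM2r ?powR_ge0 // -expRD ler_expR.
  by have := HC x x0; lra.
have [b0|b0] := leP 0 b.
  have [C HC] := ln_le_linear b0 (@ltr01 R).
  exists C => x x0; have := HC x x0; have : 0 < t / x by rewrite divr_gt0.
  by lra.
have [C HC] := ln_le_linear (ltW (etrans (oppr_gt0 b) b0)) t0.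
exists C => x x0; have := HC x^-1; rewrite invr_gt0 lnV ?posrE // => /(_ x0).
by lra.
Qed.

Lemma horner_weight_le_powR (R : realType) (nu t : R) (p : {poly R}) (a : R) :
  0 < t ->
  exists C, forall x, 0 < x -> `|p.[x] * weight nu t x| <= C * x `^ a.
Proof.
move=> t0; elim/poly_ind: p a => [|p c IHp] a.
  by exists 0 => x x0; rewrite horner0 !mul0r normr0.
have [C HC] := IHp (a - 1); have [C' HC'] := weight_le_powR nu a t0.
exists (C + `|c| * C') => x x0; rewrite hornerMXaddC mulrDl mulrDl.
apply: (le_trans (ler_normD _ _)); apply: lerD; last first.
  rewrite normrM [X in _ * X]ger0_norm ?weight_ge0 //.
  by rewrite -mulrA ler_wpM2l ?HC'.
have -> : x `^ a = x `^ (a - 1) * x.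
  rewrite -{1}(subrK 1 a) (@powRD _ x (a - 1) 1).
    by rewrite powRr1 // ltW.
  by rewrite (gt_eqF x0) implybT.
by rewrite mulrAC normrM (gtr0_norm x0) mulrA ler_wpM2r ?HC // ltW.
Qed.

Lemma is_derive_weight (R : realType) (nu t x : R) : 0 < x ->
  is_derive x 1 (weight nu t) ((- 1 + t / x ^+ 2 + nu / x) * weight nu t x).
Proof.
move=> x0.
have dV : is_derive x 1 (fun y : R => y^-1) (- x ^- 2 *: 1).
  by apply: is_deriveV; rewrite gt_eqF.
have dE : is_derive x 1 (fun y : R => - y - t / y) (- 1 - t *: (- x ^- 2 *: 1)).
  exact: is_deriveB.
have dP := is_derive1_powR nu x0.
have -> : weight nu t = (expR \o (fun y : R => - y - t / y)) * ((@powR R)^~ nu).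
  by [].
have dW := is_deriveM (is_derive1_comp (@is_derive_expR R _) dE) dP.
apply: (trigger_derive dW).
rewrite powRB; last by rewrite (gt_eqF x0) implybT.
rewrite powRr1 ?ltW // /GRing.scale /= !mulrfctE /=.
by field; rewrite gt_eqF.
Qed.

(** The factor x^2 clears the denominators of w' / w, so that the derivative is
    again a polynomial multiple of the weight. *)
Lemma is_derive_horner_weight (R : realType) (nu t x : R) (p : {poly R}) :
  0 < x ->
  is_derive x 1 (fun y => ('X^2 * p).[y] * weight nu t y)
    (('X^2 * p^`() + ((2 + nu) *: 'X - 'X^2 + t%:P) * p).[x] * weight nu t x).
Proof.
move=> x0; have dW := is_derive_weight nu t x0.
apply: (trigger_derive (is_deriveM (is_derive_poly ('X^2 * p) x) dW)).
rewrite /GRing.scale /= derivM derivXn; move: (weight nu t x) => w.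
rewrite !(hornerD, hornerM, hornerN, hornerZ, hornerMn, hornerXn, hornerX).
rewrite hornerC /=.
by field; rewrite gt_eqF.
Qed.

Lemma continuous_horner_weight (R : realType) (nu t x : R) (p : {poly R}) :
  0 < x -> {for x, continuous (fun y => p.[y] * weight nu t y)}.
Proof.
move=> x0; have dW := is_derive_weight nu t x0.
apply: cvgM; first exact: continuous_horner.
apply: differentiable_continuous; apply/derivable1_diffP; exact: ex_derive.
Qed.

(** * Integrating a derivative over the half-line *)

Section IntegralOfDerivative.
Variables (R : realType) (f F : R -> R) (l0 l : R).
Local Notation mu := (@lebesgue_measure R).
Hypothesis dF : forall x : R, 0 < x -> is_derive x 1 F (f x).
Hypothesis f_cont : forall x : R, 0 < x -> {for x, continuous f}.
Hypothesis f_int : mu.-integrable `]0, +oo[ (EFin \o f).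
Hypothesis F_cvg0 : F x @[x --> 0^'+] --> l0.
Hypothesis F_cvgy : F x @[x --> +oo] --> l.

Lemma FTC_compact a b : 0 < a -> a < b ->
  (\int[mu]_(x in `[a, b]) (f x)%:E = (F b - F a)%:E)%E.
Proof.
move=> a0 ab; rewrite (@continuous_FTC2 _ f F) ?EFinB //.
- apply: continuous_in_subspaceT => x /set_mem /=; rewrite in_itv /= => /andP[ax _].
  by apply: f_cont; exact: lt_le_trans ax.
- have cF (x : R) : 0 < x -> {for x, continuous F}.
    move=> x0; have dFx := dF x0; apply: differentiable_continuous.
    by apply/derivable1_diffP; exact: ex_derive.
  split.
  + move=> x; rewrite in_itv /= => /andP[ax _].
    by have dFx := dF (lt_trans a0 ax); exact: ex_derive.
  + by apply: cvg_at_right_filter; exact: cF.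
  + by apply: cvg_at_left_filter; apply: cF; exact: lt_trans ab.
- move=> x; rewrite in_itv /= => /andP[ax _].
  by have dFx := dF (lt_trans a0 ax); rewrite derive1E derive_val.
Qed.

(** The integrand has no constant sign, so monotone convergence does not apply;
    instead the integrals over [1 / (n + 2), n + 2] converge to the integral
    over ]0, +oo[ by dominated convergence, with |f| as the bound. *)
Lemma integral_derivative_0y : \int[mu]_(x in `]0, +oo[) f x = l - l0.
Proof.
pose a n : R := n.+2%:R^-1; pose b n : R := n.+2%:R.
have a_gt0 n : 0 < a n by rewrite invr_gt0.
have ab n : a n < b n.
  by rewrite (@lt_trans _ _ 1) ?invf_lt1 ?ltr1n.
have a_cvg : a @ \oo --> (0 : R).
  by have := @cvg_harmonic R; rewrite -(cvg_shiftn 1); under eq_fun do rewrite addn1.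
have b_cvg : b @ \oo --> +oo.
  by have := @cvgr_idn R; rewrite -(cvg_shiftn 2); under eq_fun do rewrite addn2.
pose D : set R := `]0, +oo[%classic; pose g n := (EFin \o f) \_ `[a n, b n].
have mD : measurable D by exact: measurable_itv.
have mf : measurable_fun D (EFin \o f) by case/integrableP: f_int.
have sub_abD n : `[a n, b n] `<=` D.
  by move=> x; rewrite /D /= !in_itv /= andbT => /andP[/(lt_le_trans (a_gt0 n))].
have mg n : measurable_fun D (g n).
  apply/(measurable_restrict _ (measurable_itv _)) => //.
  by apply: measurable_funS mf => //; exact: subIsetl.
have gf : {ae mu, forall x, D x -> g ^~ x @ \oo --> (EFin \o f) x}.
  apply: aeW => x; rewrite /D /= in_itv /= andbT => x0.
  apply: cvg_near_cst; near=> n; rewrite /g patchE mem_set //= in_itv /=.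
  apply/andP; split; near: n; last exact: (cvgryPge _).1 b_cvg x.
  by near do apply: ltW; exact: (cvgr_lt _ a_cvg).
have g_le : {ae mu, forall x n, D x -> (`|g n x| <= `|(EFin \o f) x|)%E}.
  by apply: aeW => x n _; rewrite /g patchE; case: ifP => // _; rewrite abse0.
have [_ _ gf_cvg] :=
  dominated_convergence (mu := mu) mD mg mf gf (integrable_abse f_int) g_le.
have gE n : (\int[mu]_(x in D) g n x = (F (b n) - F (a n))%:E)%E.
  rewrite /g -integral_mkcondr setIidr; last exact: sub_abD.
  exact: FTC_compact.
have F_cvg : F (b n) - F (a n) @[n --> \oo] --> l - l0.
  apply: cvgB; first exact: ((cvg_pinftyP F l).1 F_cvgy b b_cvg).
  exact: ((cvg_at_rightP F 0 l0).1 F_cvg0 a (conj a_gt0 a_cvg)).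
rewrite -[RHS]/(fine (l - l0)%:E); congr fine; apply: (cvg_unique _ gf_cvg) => //.
apply: (@cvg_trans _ ((F (b n) - F (a n))%:E @[n --> \oo])).
  by apply: near_eq_cvg; near=> n; exact/esym/gE.
by apply/fine_cvgP; split; [near=> n|exact: F_cvg].
Unshelve. all: by end_near. Qed.
End IntegralOfDerivative.

(** * Integration against the weight *)

Section WeightFunctional.
Variables (R : realType) (nu t : R) (P : nat -> {poly R}).
Hypothesis t_gt0 : 0 < t.
Hypothesis hP : orthonormal_polys nu t P.
Local Notation mu := (@lebesgue_measure R).
Local Notation D := (`]0, +oo[%classic : set R).

Lemma measurable_horner_weight (p : {poly R}) :
  measurable_fun D (fun x : R => p.[x] * weight nu t x).
Proof.
apply: open_continuous_measurable_fun; first exact: interval_open.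
move=> x /set_mem /=; rewrite in_itv /= andbT; exact: continuous_horner_weight.
Qed.

(** A measurable function whose positive or negative part has infinite integral
    has no finite integral, so orthonormality makes every P_n P_m w integrable. As P_0 is a nonzero
    constant and the degrees of the P_n run through all the naturals, the products
    P_n P_0 span all polynomials. *)
Lemma integrable_horner_weight (p : {poly R}) :
  mu.-integrable D (EFin \o (fun x => p.[x] * weight nu t x)).
Proof.
have [size_P _ P_orth] := hP.
have mD : measurable D by exact: measurable_itv.
have int_PP n m : mu.-integrable D
    (EFin \o (fun x => (P n * P m).[x] * weight nu t x)).
  have mPP := measurable_horner_weight (P n * P m).
  apply/integrableP; split; first exact/measurable_EFinP.
  rewrite integral_fin_num_abs //.
  under eq_integral do rewrite hornerM.
  by rewrite P_orth.
elim: {p}(size p) {-2}p (leqnn (size p)) => [p|n IHn p sp].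
  rewrite leqn0 size_poly_eq0 => /eqP ->.
  apply: (eq_integrable (mu := mu) mD (cst 0%E)); last exact: integrable0.
  by move=> x _ /=; rewrite horner0 mul0r.
pose c := p`_n / (P n)`_n / (P 0)`_0.
have -> : p = (p - (p`_n / (P n)`_n) *: P n) + c *: (P n * P 0).
  have P0E : P 0 = ((P 0)`_0)%:P by apply: size1_polyC; rewrite size_P.
  rewrite P0E [P n * _]mulrC mul_polyC scalerA divfK ?subrK //.
  exact: leading_neq0.
set q := p - _; have sq : (size q <= n)%N by exact: size_sub_leading.
apply: (eq_integrable (mu := mu) mD (fun x => ((q.[x] * weight nu t x)%:E +
    c%:E * ((P n * P 0).[x] * weight nu t x)%:E)%E)).
  by move=> x _ /=; rewrite -EFinM -EFinD hornerD hornerZ; congr EFin; ring.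
apply: integrableD => //; first exact: IHn.
exact: integrableZl (int_PP _ _).
Qed.

Definition weight_functional (p : {poly R}) : R :=
  \int[mu]_(x in D) (p.[x] * weight nu t x).

Lemma weight_functional_linear : scalar weight_functional.
Proof.
move=> c p q; have mD : measurable D by exact: measurable_itv.
rewrite /weight_functional -RintegralZl //; last exact: integrable_horner_weight.
rewrite -RintegralD //; last 2 first.
- have := integrable_horner_weight (c *: p); apply: eq_integrable => // x _ /=.
  by rewrite hornerZ -mulrA.
- exact: integrable_horner_weight.
by apply: eq_Rintegral => x _; rewrite hornerD hornerZ mulrDl -mulrA.
Qed.

(** This is the integral of the derivative of x^2 p w. The bounds
    |x^2 p w| <= C x and |x^2 p w| <= C / x make the boundary terms vanish at
    0 and +oo respectively. *)
Lemma weight_functional_pearson (p : {poly R}) :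
  weight_functional ('X^2 * p^`() + ((2 + nu) *: 'X - 'X^2 + t%:P) * p) = 0.
Proof.
rewrite -[RHS](subrr 0).
apply: (integral_derivative_0y (F := fun x => ('X^2 * p).[x] * weight nu t x)).
- move=> x; exact: is_derive_horner_weight.
- move=> x; exact: continuous_horner_weight.
- exact: integrable_horner_weight.
- have [C HC] := horner_weight_le_powR nu ('X^2 * p) 1 t_gt0.
  apply/norm_cvg0P.
  apply: (squeeze_cvgr (f := cst 0) (h := fun x => C * x `^ 1)).
  + near=> x; rewrite normr_ge0 HC //=; near: x; exact: nbhs_right_gt.
  + exact: cvg_cst.
  + rewrite -[X in _ --> X](mulr0 C); apply: cvgMr; exact: powR_cvg0.
- have [C HC] := horner_weight_le_powR nu ('X^2 * p) (-1) t_gt0.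
  apply/norm_cvg0P.
  apply: (squeeze_cvgr (f := cst 0) (h := fun x => C * x `^ (-1))).
  + near=> x; rewrite normr_ge0 HC //=; near: x; exact: nbhs_pinfty_gt.
  + exact: cvg_cst.
  + rewrite -[X in _ --> X](mulr0 C); apply: cvgMr.
    apply: (@cvg_trans _ (x^-1 @[x --> +oo])).
      apply: near_eq_cvg; near=> x; rewrite powR_inv1 // ltW //.
    by apply/gtr0_cvgV0; [exact: nbhs_pinfty_gt|exact: cvg_id].
Unshelve. all: by end_near. Qed.
End WeightFunctional.

Theorem theorem1 (R : realType) (nu t : R) (t_gt0 : 0 < t)
    (P : nat -> {poly R}) (hP : orthonormal_polys nu t P)
    (n : nat) (n_ge1 : (1 <= n)%N) (x : R) :
  x ^+ 2 * derive1 (fun y : R => (P n).[y]) x =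
    (n%:R * x - coef_A P n ^+ 2 - coef_b P n / coef_a P n) * (P n).[x]
    + coef_A P n * (x + coef_B P n - nu - 1 - 2 * n%:R) * (P n.-1).[x].
Proof.
case: n n_ge1 => [//|n] _.
have [size_P _ P_orth] := hP.
have L_orth i j : weight_functional nu t (P i * P j) = (i == j)%:R.
  rewrite /weight_functional /Rintegral.
  by under eq_integral do rewrite hornerM; rewrite P_orth.
have /(congr1 (horner^~ x)) := structure_relation (weight_functional_linear hP)
  size_P L_orth (weight_functional_pearson t_gt0 hP) n.
rewrite !(hornerD, hornerN, hornerM, hornerZ, hornerXn, hornerX, hornerC).
by rewrite derivE => -> /=; ring.
Qed.
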